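(* Let $A$ be a real $m\times n$ matrix with $m<n$, let $b\in\mathbb{R}^m$ be such that $\{x\in\mathbb{R}^n:Ax=b\}$ is nonempty, and let $\varepsilon>0$. Fix $({x'}^0,w^0)\in\mathbb{R}^{2n}\times\mathbb{R}^n$ and let $\lambda_k,\mu_k\in(r_-,r_+)$ for all $k\ge 0$, where $0<r_-<r_+$. Let $({x'}^k,w^k)_{k\ge0}$ be generated from $({x'}^0,w^0)$ by the proximal reweighted $\ell^1$ algorithm $${x'}^{k+1}=\operatorname{argmin}\Big\{\sum_{i=1}^n(x'_i+x'_{i+n}+\varepsilon)w_i^k+\frac{1}{2\lambda_k}\sum_{i=1}^{2n}(x'_i-{x'}^k_i)^2:\ x'\in\mathbb{R}_+^{2n},\ [A,-A]x'=b\Big\},$$ $$w^{k+1}=\operatorname{argmin}\Big\{\sum_{i=1}^n({x'}^{k+1}_i+{x'}^{k+1}_{i+n}+\varepsilon)w_i-\sum_{i=1}^n\log w_i+\frac{1}{2\mu_k}\sum_{i=1}^n(w_i-w_i^k)^2:\ w\in\mathbb{R}^n\Big\}.$$ Then the sequence $({x'}^k,w^k)$ converges to a point $(x',w)$ and there exist positive constants $d,r$ such that $$\|({x'}^k,w^k)-(x',w)\|\le\frac{d}{k^r},\qquad\forall k\ge1.$$ Moreover, if we set $x=(x'_1-x'_{1+n},\ldots,x'_i-x'_{i+n},\ldots,x'_n-x'_{2n})\in\mathbb{R}^n$, then $x$ is a solution of the weighted minimization problem $$\min\Big\{\sum_{i=1}^n w_i|\xi_i|:\ \xi\in\mathbb{R}^n,\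 A\xi=b\Big\}$$ with weights $w_i=1/(|x_i|+\varepsilon)$, $i=1,\ldots,n$.
   Context: $\|\cdot\|$ is the Euclidean norm, $\mathbb{R}_+^{2n}$ is the set of vectors of $\mathbb{R}^{2n}$ with nonnegative components, and $[A,-A]$ is the $m\times 2n$ block matrix. The term $-\sum_{i=1}^n\log w_i$ is understood as $+\infty$ unless $w_i>0$ for all $i\in\{1,\ldots,n\}$. *)

(* Defs.v *)
From mathcomp Require Import all_boot all_order all_algebra.
From mathcomp Require Import all_classical all_reals all_analysis.

Set Implicit Arguments.
Unset Strict Implicit.
Unset Printing Implicit Defensive.

Import Order.TTheory GRing.Theory Num.Theory.
Import numFieldNormedType.Exports.

Local Open Scope classical_set_scope.
Local Open Scope ring_scope.

(* The norm `|v| of MathComp-Analysis on matrices is the sup norm. *)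
Definition norm2 (R : realType) (n : nat) (v : 'cV[R]_n) : R :=
  Num.sqrt (\sum_(i < n) v i 0 ^+ 2).

Definition argmin (R : realType) (T : Type) (D : set T) (f : T -> \bar R) :
    set T :=
  [set x | D x /\ forall y, D y -> (f x <= f y)%E].

Definition feasible (R : realType) (m n : nat) (A : 'M[R]_(m, n))
    (b : 'cV[R]_m) : set 'cV[R]_n :=
  [set x | A *m x = b].

(* - \sum_i log w_i, with value +oo unless every w_i is positive
   (the library's ln is 0 on nonpositive reals). *)
Definition neg_sum_log (R : realType) (n : nat) (w : 'cV[R]_n) : \bar R :=
  if [forall i, 0 < w i 0] then (- \sum_(i < n) ln (w i 0))%:E else +oo%E.

(* R^2n is 'cV[R]_(n + n): x'_i is the entry lshift n i and x'_(i+n) the entry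
   rshift n i. *)
Definition weighted_sum (R : realType) (n : nat) (eps : R)
    (x' : 'cV[R]_(n + n)) (w : 'cV[R]_n) : R :=
  \sum_(i < n) (x' (lshift n i) 0 + x' (rshift n i) 0 + eps) * w i 0.

Definition x_step (R : realType) (m n : nat) (A : 'M[R]_(m, n))
    (b : 'cV[R]_m) (eps lam : R) (xk : 'cV[R]_(n + n)) (wk : 'cV[R]_n) :
    set 'cV[R]_(n + n) :=
  argmin [set x' : 'cV[R]_(n + n) |
            (forall i, 0 <= x' i 0) /\ feasible (row_mx A (- A)) b x']
    (fun x' => (weighted_sum eps x' wk +
                (2 * lam)^-1 * \sum_(i < n + n) (x' i 0 - xk i 0) ^+ 2)%:E).

Definition w_step (R : realType) (n : nat) (eps mu : R)
    (xk1 : 'cV[R]_(n + n)) (wk : 'cV[R]_n) : set 'cV[R]_n :=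
  argmin [set: 'cV[R]_n]
    (fun w => (weighted_sum eps xk1 w)%:E + neg_sum_log w +
              ((2 * mu)^-1 * \sum_(i < n) (w i 0 - wk i 0) ^+ 2)%:E)%E.

(* Main.v *)
Require Import Defs.
From mathcomp Require Import all_boot all_order all_algebra.
From mathcomp Require Import all_classical all_reals all_analysis.
From mathcomp Require Import ring lra.

Set Implicit Arguments.
Unset Strict Implicit.
Unset Printing Implicit Defensive.

Import Order.TTheory GRing.Theory Num.Theory.
Import numFieldNormedType.Exports.

Local Open Scope classical_set_scope.
Local Open Scope ring_scope.

(** The algorithm alternates proximal minimizations of the energy
      sum_i (x'_i + x'_(i+n) + eps) w_i - sum_i log w_i
    over the polyhedron { x' >= 0, [A, -A] x' = b }. Writing s_i for the slack
    x'_i + x'_(i+n) + eps, its minimum over w is attained at w = 1/s and equals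
    logsum x' = sum_i (1 + log s_i), a concave function of x'. Concavity makes the
    convergence linear.

    Each step decreases the energy by at least a multiple of its squared length
    (run_descent), and the energies, bounded below, decrease to a limit L. The
    first-order condition on w shows that the energy exceeds logsum only by a
    multiple of the last decrease (run_energy_le_logsum). The first-order
    condition on x' holds in both directions along the face of an iterate, so, by
    concavity, an iterate at which the step is small almost maximizes logsum over
    its face (run_logsum_face). There are finitely many faces: from some
    rank on, the face of each iterate is also the face of arbitrarily late
    iterates, whose steps vanish and whose logsum is at most their energy.
    Therefore logsum is eventually at most L, and
      E_(k+1) - L <= C (E_k - E_(k+1))
    for all large k (run_energy_gap), which is the inequality that the
    Kurdyka-Lojasiewicz method with exponent 1/2 would yield. The gaps E_k - L,
    and with them the lengths of the steps, decay geometrically; the sequence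
    converges at a geometric rate (run_linear_cvg), faster than d / k.

    In the limit the first-order conditions become w = 1/s and the minimality of
    x' for the linear cost with weights w (run_limit_critical). Comparing x' with
    the lifts of the feasible points xi to their positive and negative parts gives
    both s_i = |x_i| + eps and the optimality of x (lifted_minimizer). *)

(** * Elementary inequalities *)

(** Divide by t and let t tend to 0. *)
Lemma ge0_of_small_quadratic (R : realFieldType) (a c d : R) : 0 < d ->
  (forall t, 0 < t <= d -> 0 <= a * t + c * t ^+ 2) -> 0 <= a.
Proof.
move=> d0 h; rewrite leNgt; apply/negP => a0.
have c1 : 0 < `|c| + 1 by rewrite ltr_wpDl.
pose t := Num.min d (- a / (2 * (`|c| + 1))).
have t0 : 0 < t by rewrite lt_min d0 divr_gt0 // ?oppr_gt0 // mulr_gt0.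
have td : t <= d by rewrite ge_min lexx.
have tc : t * (2 * (`|c| + 1)) <= - a.
  by rewrite -ler_pdivlMr ?mulr_gt0 // ge_min lexx orbT.
have := h t; rewrite t0 td => /(_ isT).
have cc := ler_norm c.
have : c * t <= `|c| * t by rewrite ler_pM2r.
rewrite expr2 mulrA -mulrDl pmulr_lge0 //.
nra.
Qed.

Lemma ln_le_sub1 (R : realType) (x : R) : 0 < x -> ln x <= x - 1.
Proof.
move=> x0; have := @le_ln1Dx R (x - 1); rewrite addrCA subrr addr0; apply.
by rewrite ltrBrDl subrr.
Qed.

Lemma ln_ge_1subV (R : realType) (x : R) : 0 < x -> 1 - x^-1 <= ln x.
Proof.
move=> x0; have := @ln_le_sub1 R x^-1; rewrite invr_gt0 lnV ?posrE // => /(_ x0).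
lra.
Qed.

(** With u = h/w, log (1 + u) >= 1 - 1/(1 + u) >= u - 2 u^2 since |u| <= 1/2. *)
Lemma ln_expansion (R : realType) (w h : R) : 0 < w -> `|h| <= w / 2 ->
  h / w - 2 * (h / w) ^+ 2 <= ln (w + h) - ln w.
Proof.
move=> w0 hw; set u := h / w.
have u2 : `|u| <= 1 / 2.
  by rewrite normf_div (gtr0_norm w0) ler_pdivrMr // mulrC mulrA mulr1.
have {u2} [ul uu] : - (1 / 2) <= u /\ u <= 1 / 2.
  by move: u2; rewrite ler_norml => /andP[].
have u0 : 0 < 1 + u by lra.
have -> : w + h = w * (1 + u) by rewrite /u; field; rewrite gt_eqF.
rewrite lnM ?posrE // addrAC subrr add0r.
apply: le_trans (ln_ge_1subV u0).
suff : (1 + u)^-1 <= 1 - u + 2 * u ^+ 2 by lra.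
rewrite -div1r ler_pdivrMr //; nra.
Qed.

(** * Optimality conditions of one step *)

Definition polyhedron (R : realType) (m n : nat) (A : 'M[R]_(m, n))
    (b : 'cV[R]_m) : set 'cV[R]_(n + n) :=
  [set x' : 'cV[R]_(n + n) |
    (forall i, 0 <= x' i 0) /\ feasible (row_mx A (- A)) b x'].

Definition slack (R : realType) (n : nat) (eps : R) (x : 'cV[R]_(n + n))
    (i : 'I_n) : R := x (lshift n i) 0 + x (rshift n i) 0 + eps.

(** For positive w, the objective of either step without its proximal term and up
    to terms that do not depend on the minimized variable. *)
Definition energy (R : realType) (n : nat) (eps : R) (x : 'cV[R]_(n + n))
    (w : 'cV[R]_n) : R :=
  weighted_sum eps x w - \sum_(i < n) ln (w i 0).

Lemma weighted_sum_line (R : realType) (n : nat) (eps t : R)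
    (x y : 'cV[R]_(n + n)) (w : 'cV[R]_n) :
  weighted_sum eps (x + t *: (y - x)) w =
  weighted_sum eps x w + t * (weighted_sum eps y w - weighted_sum eps x w).
Proof.
rewrite /weighted_sum -sumrB mulr_sumr -big_split /=; apply: eq_bigr => i _.
by rewrite !mxE; ring.
Qed.

Lemma feasible_line (R : realType) (m n : nat) (A : 'M[R]_(m, n))
    (b : 'cV[R]_m) (t : R) (x y : 'cV[R]_n) :
  feasible A b x -> feasible A b y -> feasible A b (x + t *: (y - x)).
Proof.
rewrite /feasible /= => xb yb.
by rewrite mulmxDr -scalemxAr mulmxBr xb yb subrr scaler0 addr0.
Qed.

Lemma polyhedron_segment (R : realType) (m n : nat) (A : 'M[R]_(m, n))
    (b : 'cV[R]_m) (t : R) (x y : 'cV[R]_(n + n)) :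
  polyhedron A b x -> polyhedron A b y -> 0 <= t <= 1 ->
  polyhedron A b (x + t *: (y - x)).
Proof.
move=> [x0 xb] [y0 yb] /andP[t0 t1]; split; last exact: feasible_line.
move=> i; rewrite !mxE; have := x0 i; have := y0 i; nra.
Qed.

Lemma x_step_le (R : realType) (m n : nat) (A : 'M[R]_(m, n))
    (b : 'cV[R]_m) (eps lam : R) (xk x y : 'cV[R]_(n + n)) (wk : 'cV[R]_n) :
  x_step A b eps lam xk wk x -> polyhedron A b y ->
  weighted_sum eps x wk +
    (2 * lam)^-1 * \sum_(i < n + n) (x i 0 - xk i 0) ^+ 2 <=
  weighted_sum eps y wk +
    (2 * lam)^-1 * \sum_(i < n + n) (y i 0 - xk i 0) ^+ 2.
Proof. by move=> [_ h] /h; rewrite lee_fin. Qed.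

(** First-order condition for a convex objective on a convex set, obtained by
    comparing x with the points of the segment from x to y near x. *)
Lemma x_step_variational (R : realType) (m n : nat) (A : 'M[R]_(m, n))
    (b : 'cV[R]_m) (eps lam : R) (xk x y : 'cV[R]_(n + n)) (wk : 'cV[R]_n) :
  0 < lam -> x_step A b eps lam xk wk x -> polyhedron A b y ->
  0 <= weighted_sum eps y wk - weighted_sum eps x wk +
       lam^-1 * \sum_(i < n + n) (x i 0 - xk i 0) * (y i 0 - x i 0).
Proof.
move=> lam0 hx Py.
pose Q := \sum_(i < n + n) (y i 0 - x i 0) ^+ 2.
apply: (@ge0_of_small_quadratic _ _ ((2 * lam)^-1 * Q) 1) => // t /andP[t0 t1].
have Px : polyhedron A b x by case: hx.
have t01 : 0 <= t <= 1 by rewrite (ltW t0) t1.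
have := x_step_le hx (polyhedron_segment Px Py t01).
rewrite weighted_sum_line.
have -> : \sum_(i < n + n) ((x + t *: (y - x)) i 0 - xk i 0) ^+ 2 =
  \sum_(i < n + n) (x i 0 - xk i 0) ^+ 2 +
  2 * t * \sum_(i < n + n) (x i 0 - xk i 0) * (y i 0 - x i 0) + t ^+ 2 * Q.
  rewrite /Q !mulr_sumr -!big_split /=; apply: eq_bigr => i _.
  by rewrite !mxE; ring.
rewrite invfM.
set S1 := \sum_(i < _) _; set S2 := \sum_(i < _) _; set W1 := weighted_sum _ _ _.
set W2 := weighted_sum _ _ _; set l := lam^-1.
lra.
Qed.

(** The value +oo off the positive orthant makes any minimizer positive; against
    positive competitors the comparison is one of reals. *)
Lemma w_step_le (R : realType) (n : nat) (eps mu : R)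
    (x : 'cV[R]_(n + n)) (wk w v : 'cV[R]_n) :
  w_step eps mu x wk w -> (forall i, 0 < v i 0) ->
  (forall i, 0 < w i 0) /\
  energy eps x w + (2 * mu)^-1 * \sum_(i < n) (w i 0 - wk i 0) ^+ 2 <=
  energy eps x v + (2 * mu)^-1 * \sum_(i < n) (v i 0 - wk i 0) ^+ 2.
Proof.
move=> [_ /(_ v I)] h v0; move: h; rewrite /neg_sum_log.
have -> : [forall i, 0 < v i 0] by apply/forallP.
case: ifPn => [/forallP w0|_]; last by rewrite addeC /= leNgt ltry.
by rewrite -!EFinD lee_fin.
Qed.

Lemma w_step_gt0 (R : realType) (n : nat) (eps mu : R)
    (x : 'cV[R]_(n + n)) (wk w : 'cV[R]_n) :
  w_step eps mu x wk w -> forall i, 0 < w i 0.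
Proof.
by move=> hw; case: (@w_step_le _ _ _ _ _ _ _ (const_mx 1) hw) => // i; rewrite mxE.
Qed.

(** Moving w_i by a small h of either sign changes the objective by at most
    g h + c h^2, where g is the derivative of the objective in w_i, so g = 0. *)
Lemma w_step_stationary (R : realType) (n : nat) (eps mu : R)
    (x : 'cV[R]_(n + n)) (wk w : 'cV[R]_n) :
  w_step eps mu x wk w ->
  forall i, slack eps x i - (w i 0)^-1 = - (mu^-1 * (w i 0 - wk i 0)).
Proof.
move=> hw i; have w0 := w_step_gt0 hw.
set g := slack eps x i - (w i 0)^-1 + mu^-1 * (w i 0 - wk i 0).
have wi0 := w0 i.
pose c := 2 / w i 0 ^+ 2 + (2 * mu)^-1.
have key h : `|h| <= w i 0 / 2 -> 0 <= g * h + c * h ^+ 2.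
  move=> hh.
  pose v := w + h *: delta_mx i 0.
  have vi : v i 0 = w i 0 + h by rewrite !mxE !eqxx mulr1.
  have vj j : j != i -> v j 0 = w j 0.
    by move=> /negPf ji; rewrite !mxE ji mulr0 addr0.
  have v0 j : 0 < v j 0.
    have [->|/vj -> //] := eqVneq j i; rewrite vi.
    by move: hh; rewrite ler_norml => /andP[]; lra.
  have [_] := w_step_le hw v0.
  rewrite /energy /weighted_sum.
  rewrite !(bigD1 i (P := predT)) //= vi.
  under [in X in _ <= X]eq_bigr => j ji do rewrite vj //.
  under [X in _ <= _ - (_ + X) + _]eq_bigr => j ji do rewrite vj //.
  under [X in _ <= _ + _ * (_ + X)]eq_bigr => j ji do rewrite vj //.
  set S1 := \sum_(j < n | _) _; set S2 := \sum_(j < n | _) _.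
  set S3 := \sum_(j < n | _) _ => H.
  have := ln_expansion wi0 hh; rewrite -/(slack eps x i) in H *.
  have -> : c * h ^+ 2 = 2 * (h / w i 0) ^+ 2 + mu^-1 * h ^+ 2 / 2.
    by rewrite /c (invfM 2 mu); move: (mu^-1) => l; field; rewrite gt_eqF.
  rewrite /g.
  have -> : (slack eps x i - (w i 0)^-1 + mu^-1 * (w i 0 - wk i 0)) * h =
    slack eps x i * h - h / w i 0 + mu^-1 * (w i 0 - wk i 0) * h by ring.
  move: H; rewrite (invfM 2 mu); set l1 := ln _; set l2 := ln _; set q := h / w i 0.
  set mm := mu^-1; lra.
suff : g = 0 by rewrite /g => /eqP; rewrite addr_eq0 => /eqP.
apply/eqP; rewrite eq_le -oppr_ge0; apply/andP; split.
  apply: (@ge0_of_small_quadratic _ _ c (w i 0 / 2)); first by lra.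
  move=> t /andP[t0 t1].
  by have := key (- t); rewrite normrN gtr0_norm // sqrrN mulrN mulNr; apply.
apply: (@ge0_of_small_quadratic _ _ c (w i 0 / 2)); first by lra.
by move=> t /andP[t0 t1]; apply: key; rewrite gtr0_norm.
Qed.

(** * The energy and its partial minimum *)

Lemma slack_ge (R : realType) (n : nat) (eps : R) (x : 'cV[R]_(n + n))
    (i : 'I_n) : (forall j, 0 <= x j 0) -> eps <= slack eps x i.
Proof. by move=> x0; rewrite /slack lerDr addr_ge0. Qed.

Lemma slack_gt0 (R : realType) (n : nat) (eps : R) (x : 'cV[R]_(n + n))
    (i : 'I_n) : 0 < eps -> (forall j, 0 <= x j 0) -> 0 < slack eps x i.
Proof. by move=> e0 x0; exact: lt_le_trans e0 (slack_ge eps i x0). Qed.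

Lemma energyE (R : realType) (n : nat) (eps : R) (x : 'cV[R]_(n + n))
    (w : 'cV[R]_n) :
  energy eps x w = \sum_(i < n) (slack eps x i * w i 0 - ln (w i 0)).
Proof. by rewrite sumrB. Qed.

(** The minimum of the energy over w, attained at w_i = 1/slack_i. *)
Definition logsum (R : realType) (n : nat) (eps : R) (x : 'cV[R]_(n + n)) : R :=
  \sum_(i < n) (1 + ln (slack eps x i)).

(** log t <= t - 1 at t = s_i w_i. *)
Lemma logsum_le_energy (R : realType) (n : nat) (eps : R)
    (x : 'cV[R]_(n + n)) (w : 'cV[R]_n) :
  0 < eps -> (forall j, 0 <= x j 0) -> (forall i, 0 < w i 0) ->
  logsum eps x <= energy eps x w.
Proof.
move=> e0 x0 w0; rewrite energyE; apply: ler_sum => i _.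
have s0 := slack_gt0 i e0 x0.
have := ln_le_sub1 (mulr_gt0 s0 (w0 i)); rewrite lnM ?posrE //; lra.
Qed.

(** log t >= 1 - 1/t at t = s_i w_i bounds t - 1 - log t by (t - 1)^2 / t, which is
    quadratic in the residual of the stationarity condition s_i = 1/w_i. *)
Lemma energy_le_logsum (R : realType) (n : nat) (eps : R)
    (x : 'cV[R]_(n + n)) (w : 'cV[R]_n) :
  0 < eps -> (forall j, 0 <= x j 0) -> (forall i, 0 < w i 0) ->
  energy eps x w <= logsum eps x +
    \sum_(i < n) (slack eps x i - (w i 0)^-1) ^+ 2 * (w i 0 / slack eps x i).
Proof.
move=> e0 x0 w0; rewrite energyE -big_split /=; apply: ler_sum => i _.
have s0 := slack_gt0 i e0 x0.
have := ln_ge_1subV (mulr_gt0 s0 (w0 i)); rewrite lnM ?posrE // => H.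
have -> : (slack eps x i - (w i 0)^-1) ^+ 2 * (w i 0 / slack eps x i) =
  slack eps x i * w i 0 - 2 + (slack eps x i * w i 0)^-1.
  by field; rewrite !gt_eqF.
lra.
Qed.

(** Each term s_i w_i - log w_i is at least 1 + log s_i >= 1 + log eps, so an upper
    bound on the sum bounds each term, hence s_i; and eps w_i - log w_i bounds
    w_i. *)
Lemma energy_coercive (R : realType) (n : nat) (eps E0 : R) : 0 < eps ->
  exists2 M : R, 0 < M & forall (x : 'cV[R]_(n + n)) (w : 'cV[R]_n),
    (forall j, 0 <= x j 0) -> (forall i, 0 < w i 0) -> energy eps x w <= E0 ->
    (forall j, x j 0 <= M) /\ (forall i, w i 0 <= M).
Proof.
move=> e0; pose B := E0 + n%:R * `|1 + ln eps|.
pose Mw := (B - 1 - ln (eps / 2)) * (2 / eps).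
exists (expR B + `|Mw|); first by rewrite ltr_wpDr // expR_gt0.
move=> x w x0 w0; rewrite energyE => hE.
have term i : slack eps x i * w i 0 - ln (w i 0) <= B.
  have lb j : 0 <= slack eps x j * w j 0 - ln (w j 0) + `|1 + ln eps|.
    have s0 := slack_gt0 j e0 x0.
    have := ln_le_sub1 (mulr_gt0 s0 (w0 j)); rewrite lnM ?posrE //.
    have : ln eps <= ln (slack eps x j) by rewrite ler_ln ?posrE // slack_ge.
    have := ler_norm (- (1 + ln eps)); rewrite normrN; lra.
  have : \sum_(j < n) (slack eps x j * w j 0 - ln (w j 0) + `|1 + ln eps|) <= B.
    by rewrite big_split /= sumr_const card_ord -mulr_natl /B lerD2r.
  rewrite (bigD1 i) //=; apply: le_trans.
  by rewrite -addrA lerDl addr_ge0 // sumr_ge0.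
have sl i : slack eps x i <= expR B.
  have s0 := slack_gt0 i e0 x0.
  rewrite -[slack _ _ _]lnK ?posrE // ler_expR.
  have := ln_le_sub1 (mulr_gt0 s0 (w0 i)); rewrite lnM ?posrE //.
  have := term i; lra.
split=> [j|i].
  apply: (@le_trans _ _ (expR B)); last by rewrite lerDl.
  rewrite -[j]splitK; case: (fintype.split j) => i /=; apply: le_trans (sl i);
  rewrite /slack; [rewrite -addrA lerDl|rewrite addrAC lerDr];
  by rewrite addr_ge0 // ltW.
apply: (@le_trans _ _ Mw).
  rewrite /Mw mulrA ler_pdivlMr //.
  have := ln_le_sub1 (mulr_gt0 (w0 i) (_ : 0 < eps / 2)).
  rewrite divr_gt0 // (lnM (w0 i) (_ : eps / 2 \is Num.pos)) ?posrE ?divr_gt0 // => /(_ isT).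
  have := term i; have : eps * w i 0 <= slack eps x i * w i 0.
    by rewrite ler_pM2r // slack_ge.
  lra.
by rewrite ler_wpDl ?expR_ge0 // ler_norm.
Qed.

(** If y vanishes wherever x does, then x can be moved slightly away from y
    without leaving the polyhedron, so the first-order condition at x also holds
    in the direction x - y. *)
Lemma x_step_variational_face (R : realType) (m n : nat) (A : 'M[R]_(m, n))
    (b : 'cV[R]_m) (eps lam : R) (xk x y : 'cV[R]_(n + n)) (wk : 'cV[R]_n) :
  0 < lam -> x_step A b eps lam xk wk x -> polyhedron A b y ->
  (forall i, x i 0 = 0 -> y i 0 = 0) ->
  weighted_sum eps y wk - weighted_sum eps x wk +
    lam^-1 * \sum_(i < n + n) (x i 0 - xk i 0) * (y i 0 - x i 0) <= 0.
Proof.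
move=> lam0 hx [y0 yb] xy.
have [x0 xb] : polyhedron A b x by case: hx.
(* T bounds all ratios y_i / x_i; the ratio is 0 where x_i, and so y_i, is 0. *)
pose T := \sum_(i < n + n) y i 0 / x i 0 + 1.
have q0 i : 0 <= y i 0 / x i 0 by rewrite divr_ge0.
have T0 : 0 < T by rewrite ltr_wpDl // sumr_ge0.
have ty i : T^-1 * y i 0 <= x i 0.
  rewrite mulrC ler_pdivrMr //.
  have [xi0|xi0] := eqVneq (x i 0) 0; first by rewrite xy // xi0 mul0r.
  have xi : 0 < x i 0 by rewrite lt_def xi0 x0.
  rewrite mulrC -ler_pdivrMr // /T (bigD1 i) //= -addrA lerDl.
  by rewrite addr_ge0 // sumr_ge0.
(* x - (y - x) / T >= x - y / T >= 0. *)
have Pz : polyhedron A b (x + (- T^-1) *: (y - x)).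
  split; last exact: feasible_line.
  move=> i; rewrite !mxE; have := ty i; have := x0 i.
  have : 0 < T^-1 by rewrite invr_gt0.
  set t := T^-1; nra.
have := x_step_variational lam0 hx Pz; rewrite weighted_sum_line.
have -> : \sum_(i < n + n) (x i 0 - xk i 0) *
    ((x + - T^-1 *: (y - x)) i 0 - x i 0) =
    - T^-1 * \sum_(i < n + n) (x i 0 - xk i 0) * (y i 0 - x i 0).
  by rewrite mulr_sumr; apply: eq_bigr => i _; rewrite !mxE; ring.
set S := \sum_(i < _) _; set a := weighted_sum _ _ _; set c := weighted_sum _ _ _.
have -> : a + - T^-1 * (c - a) - a + lam^-1 * (- T^-1 * S) =
  - T^-1 * (c - a + lam^-1 * S) by ring.
by rewrite mulNr oppr_ge0 pmulr_rle0 // invr_gt0.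
Qed.

(** * Estimates along the iterations *)

(** The initial point of the algorithm is arbitrary, so feasibility of X 0 and
    positivity of W 0 are required here: they hold for the algorithm restarted
    at its first iterate. *)
Record prox_run (R : realType) (m n : nat) (A : 'M[R]_(m, n)) (b : 'cV[R]_m)
    (eps rm rp : R) (lam mu : nat -> R) (X : nat -> 'cV[R]_(n + n))
    (W : nat -> 'cV[R]_n) : Prop := ProxRun {
  run_eps : 0 < eps;
  run_rm : 0 < rm;
  run_lam : forall k, rm < lam k < rp;
  run_mu : forall k, rm < mu k < rp;
  run_x : forall k, x_step A b eps (lam k) (X k) (W k) (X k.+1);
  run_w : forall k, w_step eps (mu k) (X k.+1) (W k) (W k.+1);
  run_X : forall k, polyhedron A b (X k);
  run_W : forall k i, 0 < W k i 0 }.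

Definition run_energy (R : realType) (n : nat) (eps : R)
    (X : nat -> 'cV[R]_(n + n)) (W : nat -> 'cV[R]_n) (k : nat) : R :=
  energy eps (X k) (W k).

(** Bounds every coordinate of the k-th step; being defined by the decrease of the
    energy, it tends to 0. *)
Definition step_size (R : realType) (n : nat) (eps rp : R)
    (X : nat -> 'cV[R]_(n + n)) (W : nat -> 'cV[R]_n) (k : nat) : R :=
  Num.sqrt (2 * rp * (run_energy eps X W k - run_energy eps X W k.+1)).

(** Compare each minimizer with the previous iterate. *)
Lemma run_descent (R : realType) (m n : nat) (A : 'M[R]_(m, n)) (b : 'cV[R]_m)
    (eps rm rp : R) (lam mu : nat -> R) (X : nat -> 'cV[R]_(n + n))
    (W : nat -> 'cV[R]_n) : prox_run A b eps rm rp lam mu X W -> forall k,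
  \sum_(i < n + n) (X k.+1 i 0 - X k i 0) ^+ 2 +
  \sum_(i < n) (W k.+1 i 0 - W k i 0) ^+ 2 <=
  2 * rp * (run_energy eps X W k - run_energy eps X W k.+1).
Proof.
move=> [e0 rm0 hl hm hx hw hX hW] k.
have [lr lp] := andP (hl k); have [mr mp] := andP (hm k).
have l0 := lt_trans rm0 lr; have m0 := lt_trans rm0 mr.
have r0 := lt_trans l0 lp.
have := x_step_le (hx k) (hX k); have [_] := w_step_le (hw k) (hW k).
rewrite /run_energy /energy.
have dd0 p (u : 'cV[R]_p) : \sum_(i < p) (u i 0 - u i 0) ^+ 2 = 0.
  by apply: big1 => i _; rewrite subrr expr0n.
rewrite !dd0 !mulr0 !addr0.
set S1 := \sum_(i < n + n) _; set S2 := \sum_(i < n) (_ - _) ^+ 2.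
have S10 : 0 <= S1 by apply: sumr_ge0 => *; apply: sqr_ge0.
have S20 : 0 <= S2 by apply: sumr_ge0 => *; apply: sqr_ge0.
have : (2 * rp)^-1 * S1 <= (2 * lam k)^-1 * S1.
  by apply: ler_wpM2r => //; rewrite lef_pV2 ?posrE ?mulr_gt0 // ler_pM2l // ltW.
have : (2 * rp)^-1 * S2 <= (2 * mu k)^-1 * S2.
  by apply: ler_wpM2r => //; rewrite lef_pV2 ?posrE ?mulr_gt0 // ler_pM2l // ltW.
move=> h1 h2 h3 h4; rewrite mulrC -ler_pdivrMr ?mulr_gt0 // mulrC mulrDr.
move: h1 h2 h3 h4; lra.
Qed.

Lemma run_step_size (R : realType) (m n : nat) (A : 'M[R]_(m, n)) (b : 'cV[R]_m)
    (eps rm rp : R) (lam mu : nat -> R) (X : nat -> 'cV[R]_(n + n))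
    (W : nat -> 'cV[R]_n) : prox_run A b eps rm rp lam mu X W -> forall k,
  (forall i, `|X k.+1 i 0 - X k i 0| <= step_size eps rp X W k) /\
  (forall i, `|W k.+1 i 0 - W k i 0| <= step_size eps rp X W k).
Proof.
move=> hr k; have hd := run_descent hr k.
split=> i; rewrite -sqrtr_sqr ler_wsqrtr //; apply: le_trans hd;
  rewrite (bigD1 i) //=.
  by rewrite -addrA lerDl addr_ge0 // sumr_ge0 // => *; apply: sqr_ge0.
rewrite addrCA lerDl addr_ge0 // sumr_ge0 // => *; exact: sqr_ge0.
Qed.

Lemma run_energy_nonincreasing (R : realType) (m n : nat) (A : 'M[R]_(m, n))
    (b : 'cV[R]_m) (eps rm rp : R) (lam mu : nat -> R)
    (X : nat -> 'cV[R]_(n + n)) (W : nat -> 'cV[R]_n) :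
  prox_run A b eps rm rp lam mu X W -> forall k,
  run_energy eps X W k.+1 <= run_energy eps X W k.
Proof.
move=> hr k; have := run_descent hr k.
have [lr lp] := andP (run_lam hr k).
have r0 : 0 < 2 * rp by rewrite mulr_gt0 // (lt_trans (run_rm hr)) // (lt_trans lr).
move=> h; rewrite -subr_ge0 -(pmulr_rge0 _ r0); apply: le_trans h.
by rewrite addr_ge0 // sumr_ge0 // => *; apply: sqr_ge0.
Qed.

Lemma run_bounded (R : realType) (m n : nat) (A : 'M[R]_(m, n))
    (b : 'cV[R]_m) (eps rm rp : R) (lam mu : nat -> R)
    (X : nat -> 'cV[R]_(n + n)) (W : nat -> 'cV[R]_n) :
  prox_run A b eps rm rp lam mu X W ->
  exists2 M : R, 0 < M &
    forall k, (forall j, X k j 0 <= M) /\ (forall i, W k i 0 <= M).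
Proof.
move=> hr.
have [M M0 hM] := energy_coercive n (run_energy eps X W 0) (run_eps hr).
exists M => // k; apply: hM; [by case: (run_X hr k)|exact: run_W hr k|].
elim: k => // k; apply: le_trans; exact: run_energy_nonincreasing hr k.
Qed.

Lemma invr_bounds (R : realType) (rm r rp : R) : 0 < rm -> rm < r < rp ->
  0 < r^-1 <= rm^-1.
Proof.
move=> rm0 /andP[h _]; have r0 := lt_trans rm0 h.
by rewrite invr_gt0 r0 lef_pV2 ?posrE // ltW.
Qed.

(** Since w minimizes the energy in closed form at 1/slack, up to the proximal
    term, the energy exceeds its partial minimum only to second order in the
    step. *)
Lemma run_energy_le_logsum (R : realType) (m n : nat) (A : 'M[R]_(m, n))
    (b : 'cV[R]_m) (eps rm rp : R) (lam mu : nat -> R)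
    (X : nat -> 'cV[R]_(n + n)) (W : nat -> 'cV[R]_n) :
  prox_run A b eps rm rp lam mu X W ->
  exists2 C : R, 0 < C & forall k,
    run_energy eps X W k.+1 <=
    logsum eps (X k.+1) +
    C * (run_energy eps X W k - run_energy eps X W k.+1).
Proof.
move=> hr; have [M M0 hM] := run_bounded hr.
have [e0 rm0 hl hm hx hw hX hW] := hr.
have rp0 : 0 < rp by have /andP[h1 h2] := hl 0%N; apply: lt_trans rm0 (lt_trans h1 h2).
exists (rm^-1 ^+ 2 * (M / eps) * (2 * rp)).
  by rewrite !mulr_gt0 // ?exprn_gt0 ?invr_gt0.
move=> k; have X0 : forall j, 0 <= X k.+1 j 0 by case: (hX k.+1).
apply: le_trans (energy_le_logsum e0 X0 (hW k.+1)) _.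
rewrite lerD2l -[X in _ <= X]mulrA.
apply: (@le_trans _ _ (rm^-1 ^+ 2 * (M / eps) *
    \sum_(i < n) (W k.+1 i 0 - W k i 0) ^+ 2)); last first.
  apply: ler_wpM2l; first by rewrite mulr_ge0 ?sqr_ge0 // divr_ge0 // ltW.
  apply: le_trans (run_descent hr k); rewrite lerDr.
  by apply: sumr_ge0 => *; apply: sqr_ge0.
rewrite mulr_sumr; apply: ler_sum => i _.
rewrite (w_step_stationary (hw k)) sqrrN exprMn mulrAC.
apply: ler_wpM2r; first exact: sqr_ge0.
have /andP[mi0 mi] := invr_bounds rm0 (hm k).
have s0 := slack_gt0 i e0 X0.
apply: ler_pM; [exact: sqr_ge0|by rewrite divr_ge0 // ltW| |].
  by rewrite ler_sqr // nnegrE ltW // invr_gt0.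
apply: ler_pM; [exact: ltW|by rewrite invr_ge0 ltW|by case: (hM k.+1)|].
by rewrite lef_pV2 ?posrE // slack_ge.
Qed.

(** The concave function logsum lies below its tangent at an iterate, and by the
    first-order conditions the slope towards any point of the same face is
    controlled by the last step; an iterate with a vanishing step would
    maximize logsum over its face. *)
Lemma run_logsum_face (R : realType) (m n : nat) (A : 'M[R]_(m, n))
    (b : 'cV[R]_m) (eps rm rp : R) (lam mu : nat -> R)
    (X : nat -> 'cV[R]_(n + n)) (W : nat -> 'cV[R]_n) :
  prox_run A b eps rm rp lam mu X W ->
  exists2 C : R, 0 < C & forall k j,
    (forall i, X j.+1 i 0 = 0 -> X k i 0 = 0) ->
    logsum eps (X k) <= logsum eps (X j.+1) + C * step_size eps rp X W j.
Proof.
move=> hr; have [M M0 hM] := run_bounded hr.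
have [e0 rm0 hl hm hx hw hX hW] := hr.
pose C1 := rm^-1 * ((n + n)%:R * M); pose C2 := 2 * M * (rm^-1 * (M / eps) + 1).
have C20 : 0 < C2 by rewrite mulr_gt0 ?mulr_gt0 // addr_gt0 // mulr_gt0 ?invr_gt0 // divr_gt0.
have C10 : 0 <= C1 by rewrite !mulr_ge0 // ?invr_ge0 ltW.
(* The summand 1 makes the constant positive also when n = 0. *)
exists (C1 + n%:R * C2 + 1).
  by rewrite ltr_wpDl // addr_ge0 // mulr_ge0 // ltW.
move=> k j kj.
have [dX dW] := run_step_size hr j; set d := step_size _ _ _ _ _ in dX dW *.
have d0 : 0 <= d by rewrite sqrtr_ge0.
have X0 l i : 0 <= X l i 0 by case: (hX l) => /(_ i).
have XM l i : X l i 0 <= M by case: (hM l) => /(_ i).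
have WM l i : W l i 0 <= M by case: (hM l) => _ /(_ i).
have /andP[mi0 mi] := invr_bounds rm0 (hm j).
have /andP[li0 li] := invr_bounds rm0 (hl j).
have l0 : 0 < lam j by rewrite -invr_gt0.
have dXX l l' i : `|X l i 0 - X l' i 0| <= M.
  rewrite ler_norml; have := X0 l i; have := X0 l' i.
  have := XM l i; have := XM l' i; lra.
pose sk i := slack eps (X k) i; pose sj i := slack eps (X j.+1) i.
have sj0 i : 0 < sj i by apply: slack_gt0.
have sk0 i : 0 < sk i by apply: slack_gt0.
(* Linearize each log at s_i(X_(j+1)), then replace the slope 1/s_i by the weight
   W_j that enters the first-order condition. *)
have tangent : logsum eps (X k) - logsum eps (X j.+1) <=
    (\sum_(i < n) sk i * W j i 0 - \sum_(i < n) sj i * W j i 0) +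
    \sum_(i < n) (sk i - sj i) * ((sj i)^-1 - W j i 0).
  rewrite -!sumrB -big_split /=; apply: ler_sum => i _.
  have := ln_le_sub1 (divr_gt0 (sk0 i) (sj0 i)); rewrite ln_div ?posrE //.
  rewrite -/(sk i) -/(sj i).
  have -> : sk i / sj i - 1 = (sk i - sj i) * (sj i)^-1.
    by field; rewrite gt_eqF.
  lra.
have face := x_step_variational_face l0 (hx j) (hX k) kj.
set P := \sum_(i < n + n) _ in face.
have Pb : - ((lam j)^-1 * P) <= C1 * d.
  apply: le_trans (ler_norm _) _.
  rewrite normrN normrM (gtr0_norm li0) /C1 -mulrA.
  apply: ler_pM; [exact: ltW|by []|exact: li|].
  apply: le_trans (ler_norm_sum _ _ _) _.
  rewrite -mulrA mulr_natl -[X in _ <= _ *+ X]card_ord -sumr_const.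
  apply: ler_sum => i _; rewrite normrM mulrC.
  by apply: ler_pM.
have Qb : \sum_(i < n) (sk i - sj i) * ((sj i)^-1 - W j i 0) <= n%:R * C2 * d.
  rewrite -mulrA mulr_natl -[X in _ <= _ *+ X]card_ord -sumr_const.
  apply: ler_sum => i _.
  apply: le_trans (ler_norm _) _; rewrite normrM /C2 -[X in _ <= X]mulrA.
  apply: ler_pM => //.
    have -> : sk i - sj i = (X k (lshift n i) 0 - X j.+1 (lshift n i) 0) +
                           (X k (rshift n i) 0 - X j.+1 (rshift n i) 0).
      by rewrite /sk /sj /slack; ring.
    have -> : 2 * M = M + M by ring.
    by apply: le_trans (ler_normD _ _) _; rewrite lerD.
  (* The residual of the w-step at j, plus the change of the weight. *)
  have -> : (sj i)^-1 - W j i 0 =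
      - ((sj i - (W j.+1 i 0)^-1) * (W j.+1 i 0 / sj i)) +
      (W j.+1 i 0 - W j i 0).
    by field; rewrite !gt_eqF.
  apply: le_trans (ler_normD _ _) _.
  rewrite [X in _ <= X]mulrDl mul1r lerD //.
  rewrite normrN normrM (w_step_stationary (hw j)) normrN normrM.
  rewrite (gtr0_norm mi0) -mulrA -[X in _ <= X]mulrA.
  apply: ler_pM => //; first exact: ltW.
  rewrite mulrC.
  apply: ler_pM => //.
  rewrite ger0_norm; last by rewrite divr_ge0 // ltW.
  apply: ler_pM => //; [exact: ltW|by rewrite invr_ge0 ltW|].
  by rewrite lef_pV2 ?posrE // slack_ge.
rewrite /weighted_sum -/P in face.
have : 0 <= d by [].
move: tangent face Pb Qb; rewrite /sk /sj /slack.
set a1 := \sum_(i < n) _; set a2 := \sum_(i < n) _; set a3 := \sum_(i < n) _.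
set p := (lam j)^-1 * P; lra.
Qed.

(** * Linear convergence *)

(** A value taken only finitely often is no longer taken from some rank on, and
    there are finitely many values. *)
Lemma eventually_recurrent (T : finType) (f : nat -> T) :
  exists K, forall k, (K <= k)%N -> forall N, exists2 j, (N <= j)%N & f j = f k.
Proof.
have /choice[g hg] t : exists N, (exists j, (N <= j)%N /\ f j = t) ->
    forall N', exists2 j, (N' <= j)%N & f j = t.
  have [h|/existsNP[N hN]] :=
      pselect (forall N', exists2 j, (N' <= j)%N & f j = t).
    by exists 0%N.
  by exists N => -[j [jN fj]]; case: hN; exists j.
exists (\max_t g t) => k hk; apply: hg; exists k; split => //.
by apply: leq_trans hk; apply: leq_bigmax.
Qed.

Lemma run_energy_cvg (R : realType) (m n : nat) (A : 'M[R]_(m, n))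
    (b : 'cV[R]_m) (eps rm rp : R) (lam mu : nat -> R)
    (X : nat -> 'cV[R]_(n + n)) (W : nat -> 'cV[R]_n) :
  prox_run A b eps rm rp lam mu X W ->
  exists L : R, (forall k, L <= run_energy eps X W k) /\
    run_energy eps X W k @[k --> \oo] --> L.
Proof.
move=> hr; set E := run_energy eps X W.
have [e0 rm0 hl hm hx hw hX hW] := hr.
have dE : nonincreasing_seq E.
  by apply/nonincreasing_seqP => k; exact: run_energy_nonincreasing hr k.
have cE : cvgn E.
  apply: nonincreasing_is_cvgn => //; exists (\sum_(i < n) (1 + ln eps)).
  move=> _ [k _ <-]; have X0 : forall j, 0 <= X k j 0 by case: (hX k).
  apply: le_trans (logsum_le_energy e0 X0 (hW k)).
  apply: ler_sum => i _; rewrite lerD2l ler_ln ?posrE ?slack_gt0 //.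
  exact: slack_ge.
by exists (limn E); split => // k; exact: nonincreasing_cvgn_ge.
Qed.

(** The energy gap is eventually of the order of its own decrease. The support
    of the iterate k recurs at iterates j with arbitrarily small steps, and as
    j grows these asymptotically maximize the concave logsum over the face; so
    logsum at k does not exceed the limit of the energies. *)
Lemma run_energy_gap (R : realType) (m n : nat) (A : 'M[R]_(m, n))
    (b : 'cV[R]_m) (eps rm rp : R) (lam mu : nat -> R)
    (X : nat -> 'cV[R]_(n + n)) (W : nat -> 'cV[R]_n) (L : R) :
  prox_run A b eps rm rp lam mu X W ->
  (forall k, L <= run_energy eps X W k) ->
  run_energy eps X W k @[k --> \oo] --> L ->
  exists2 C : R, 0 < C & exists K, forall k, (K <= k)%N ->
    run_energy eps X W k.+1 - L <=
    C * (run_energy eps X W k - run_energy eps X W k.+1).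
Proof.
move=> hr LE cE.
have [e0 rm0 hl hm hx hw hX hW] := hr.
have rp0 : 0 < rp by have /andP[h1 h2] := hl 0%N; apply: lt_trans rm0 (lt_trans h1 h2).
have [C C0 hC] := run_energy_le_logsum hr.
have [D D0 hD] := run_logsum_face hr.
exists C => //.
have [K hK] := eventually_recurrent (fun k => [set i | X k.+1 i 0 == 0]%SET).
exists K => k /hK rec.
suff logL : logsum eps (X k.+1) <= L by have := hC k; lra.
apply/ler_addgt0Pr => eta eta0.
(* The first bound makes the energy at j close to L, the second one the step. *)
pose eta1 := Num.min (eta / 2) ((eta / (2 * D)) ^+ 2 / (2 * rp)).
have eta10 : 0 < eta1.
  by rewrite lt_min !divr_gt0 // ?exprn_gt0 ?divr_gt0 // mulr_gt0.
move/cvgrPdist_lt : cE => /(_ _ eta10)[N _ hN].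
have [j Nj /setP fj] := rec N.
have small l : (N <= l)%N -> run_energy eps X W l < L + eta1.
  by move/hN => /=; rewrite ltr_norml => /andP[h _]; lra.
have step : D * step_size eps rp X W j <= eta / 2.
  have -> : eta / 2 = D * (eta / (2 * D)) by field; rewrite gt_eqF.
  have eD0 : 0 <= eta / (2 * D) by rewrite ltW // divr_gt0 // mulr_gt0.
  rewrite ler_pM2l // -[X in _ <= X](ger0_norm eD0) -sqrtr_sqr.
  rewrite ler_wsqrtr // -ler_pdivlMl ?mulr_gt0 // mulrC.
  apply: (@le_trans _ _ eta1); last by rewrite ge_min lexx orbT.
  by have := small j Nj; have := LE j.+1; lra.
have face i : X j.+1 i 0 = 0 -> X k.+1 i 0 = 0.
  by move=> /eqP h; have := fj i; rewrite !inE h => /esym/eqP.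
have X0 : forall i, 0 <= X j.+1 i 0 by case: (hX j.+1).
have := hD k.+1 j face; have := logsum_le_energy e0 X0 (hW j.+1).
have := small j.+1 (leqW Nj).
have : eta1 <= eta / 2 by rewrite ge_min lexx.
rewrite /run_energy; move: step; lra.
Qed.

(** The hypothesis reads a_(k+1) <= q a_k with q = C / (1 + C); the terms below K are
    absorbed in the constant. *)
Lemma geometric_decay (R : realFieldType) (a : nat -> R) (C : R) (K : nat) :
  0 < C -> (forall k, 0 <= a k) ->
  (forall k, (K <= k)%N -> a k.+1 <= C * (a k - a k.+1)) ->
  exists D q : R, [/\ 0 < D, 0 < q, q < 1 & forall k, a k <= D * q ^+ k].
Proof.
move=> C0 a0 ha; pose q := C / (1 + C).
have C1 : 0 < 1 + C by rewrite addr_gt0.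
have q0 : 0 < q by rewrite divr_gt0.
pose D := \sum_(i < K.+1) a i / q ^+ i + 1.
have aq0 i : 0 <= a i / q ^+ i by rewrite divr_ge0 // exprn_ge0 // ltW.
have S0 : 0 <= \sum_(i < K.+1) a i / q ^+ i by apply: sumr_ge0.
exists D, q; split => //; first by rewrite ltr_wpDl.
  by rewrite ltr_pdivrMr // mul1r ltrDr.
have init k : (k <= K)%N -> a k <= D * q ^+ k.
  move=> kK; rewrite -ler_pdivrMr ?exprn_gt0 //.
  rewrite /D (bigD1 (Ordinal (kK : (k < K.+1)%N))) //= -addrA lerDl.
  by rewrite addr_ge0 // sumr_ge0.
elim=> [|k IH]; first exact: init.
have [/init //|] := leqP k.+1 K; rewrite ltnS => /ha h.
rewrite exprS mulrCA; apply: (@le_trans _ _ (q * a k)); last by rewrite ler_pM2l.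
rewrite /q mulrAC ler_pdivlMr //; lra.
Qed.

(** The remaining variation after k is at most c q^k with c = D / (1 - q), so
    u_k - c q^k increases, u_k + c q^k decreases, and both enclose the limit. *)
Lemma geometric_cvg (R : realType) (u : nat -> R) (D q : R) :
  q < 1 -> 0 < D -> 0 < q -> (forall k, `|u k.+1 - u k| <= D * q ^+ k) ->
  exists l, forall k, `|u k - l| <= D / (1 - q) * q ^+ k.
Proof.
move=> q1 D0 q0 hu; set c := D / (1 - q).
have q10 : 0 < 1 - q by rewrite subr_gt0.
have c0 : 0 < c by rewrite divr_gt0.
have cD k : c * q ^+ k - c * q ^+ k.+1 = D * q ^+ k.
  by rewrite exprS /c; field; rewrite gt_eqF.
pose lo k := u k - c * q ^+ k; pose up k := u k + c * q ^+ k.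
have lo_nd : nondecreasing_seq lo.
  apply/nondecreasing_seqP => k; have := hu k; have := cD k.
  by rewrite /lo ler_norml => h /andP[h1 h2]; lra.
have up_ni : nonincreasing_seq up.
  apply/nonincreasing_seqP => k; have := hu k; have := cD k.
  by rewrite /up ler_norml => h /andP[h1 h2]; lra.
have lo_up j k : lo j <= up k.
  apply: (@le_trans _ _ (lo (maxn j k))); first by apply: lo_nd; exact: leq_maxl.
  apply: (@le_trans _ _ (up (maxn j k))); last by apply: up_ni; exact: leq_maxr.
  have : 0 <= c * q ^+ maxn j k by rewrite mulr_ge0 ?exprn_ge0 // ltW.
  rewrite /lo /up; lra.
exists (sup (range lo)) => k.
have h1 : lo k <= sup (range lo).
  apply: sup_ubound; last by exists k.
  by exists (up 0%N) => _ [j _ <-].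
have h2 : sup (range lo) <= up k.
  by apply: sup_le_ub; [exists (lo 0%N); exists 0%N|move=> _ [j _ <-]].
by move: h1 h2; rewrite /lo /up ler_norml => h1 h2; apply/andP; split; lra.
Qed.

Lemma run_linear_cvg (R : realType) (m n : nat) (A : 'M[R]_(m, n))
    (b : 'cV[R]_m) (eps rm rp : R) (lam mu : nat -> R)
    (X : nat -> 'cV[R]_(n + n)) (W : nat -> 'cV[R]_n) :
  prox_run A b eps rm rp lam mu X W ->
  exists (xl : 'cV[R]_(n + n)) (wl : 'cV[R]_n) (C q : R),
  [/\ 0 < C, 0 < q, q < 1,
      forall k i, `|X k i 0 - xl i 0| <= C * q ^+ k &
      forall k i, `|W k i 0 - wl i 0| <= C * q ^+ k].
Proof.
move=> hr; have [L [LE cE]] := run_energy_cvg hr.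
have [B B0 [K hK]] := run_energy_gap hr LE cE.
have rp0 : 0 < rp.
  by have /andP[h1 h2] := run_lam hr 0; apply: lt_trans (run_rm hr) (lt_trans h1 h2).
have [|//|D [q [D0 q0 q1 hD]]] :=
  @geometric_decay _ (fun k => run_energy eps X W k - L) B K B0.
- by move=> k; rewrite subr_ge0.
- move=> k /hK; congr (_ <= B * _); ring.
pose s := Num.sqrt q; pose G := Num.sqrt (2 * rp * D).
have s0 : 0 < s by rewrite sqrtr_gt0.
have s1 : s < 1 by rewrite -sqrtr1 ltr_sqrt.
have G0 : 0 < G by rewrite sqrtr_gt0 !mulr_gt0.
have step k : step_size eps rp X W k <= G * s ^+ k.
  have Gs0 : 0 <= G * s ^+ k by rewrite mulr_ge0 ?exprn_ge0 // ltW.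
  rewrite -(ger0_norm Gs0) -sqrtr_sqr ler_wsqrtr //.
  rewrite exprMn exprAC (sqr_sqrtr (ltW q0)) sqr_sqrtr; last first.
    by rewrite ltW // !mulr_gt0.
  rewrite -[X in _ <= X]mulrA ler_pM2l ?mulr_gt0 //.
  by apply: le_trans (hD k); rewrite lerB.
have cvX i : exists l, forall k, `|X k i 0 - l| <= G / (1 - s) * s ^+ k.
  apply: geometric_cvg => // k; apply: le_trans (step k).
  by case: (run_step_size hr k).
have cvW i : exists l, forall k, `|W k i 0 - l| <= G / (1 - s) * s ^+ k.
  apply: geometric_cvg => // k; apply: le_trans (step k).
  by case: (run_step_size hr k).
have [xl hxl] := choice cvX; have [wl hwl] := choice cvW.
exists (\col_i xl i), (\col_i wl i), (G / (1 - s)), s; split => //.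
- by rewrite divr_gt0 // subr_gt0.
- by move=> k i; rewrite mxE.
- by move=> k i; rewrite mxE.
Qed.

(** * The limit point *)

Lemma geometric_near (R : realType) (C q e : R) : 0 < q -> q < 1 -> 0 < e ->
  \forall k \near \oo, `|C| * q ^+ k < e.
Proof.
move=> q0 q1 e0; have C1 : 0 < `|C| + 1 by rewrite ltr_wpDl.
have : q ^+ k @[k --> \oo] --> (0 : R) by apply: cvg_expr; rewrite gtr0_norm.
move/cvgrPdist_lt => /(_ (e / (`|C| + 1))); rewrite divr_gt0 // => /(_ isT).
apply: filterS => k; rewrite sub0r normrN gtr0_norm ?exprn_gt0 //.
rewrite ltr_pdivlMr //; have := exprn_gt0 k q0; nra.
Qed.

Lemma geometric_bound_cvg (R : realType) (u : nat -> R) (l C q : R) :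
  0 < q -> q < 1 -> (forall k, `|u k - l| <= C * q ^+ k) ->
  u k @[k --> \oo] --> l.
Proof.
move=> q0 q1 hu; apply/cvgrPdist_lt => e e0.
apply: filterS (geometric_near C q0 q1 e0) => k; rewrite distrC.
apply: le_lt_trans; apply: le_trans (hu k) _.
by apply: ler_wpM2r; rewrite ?ler_norm // exprn_ge0 // ltW.
Qed.

Lemma geometric_bound_cvg_mx (R : realType) (p : nat) (u : nat -> 'cV[R]_p)
    (l : 'cV[R]_p) (C q : R) :
  0 < q -> q < 1 -> (forall k i, `|u k i 0 - l i 0| <= C * q ^+ k) ->
  u k @[k --> \oo] --> l.
Proof.
move=> q0 q1 hu; apply/cvg_ballP => e e0.
apply: filterS (geometric_near C q0 q1 e0) => k hk; split => // i j.
rewrite (ord1 j) /ball /= distrC; apply: le_lt_trans (hu k i) (le_lt_trans _ hk).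
by apply: ler_wpM2r; rewrite ?ler_norm // exprn_ge0 // ltW.
Qed.

Lemma cvg_sumr (R : realType) (I : finType) (f : I -> nat -> R) (l : I -> R) :
  (forall i, f i k @[k --> \oo] --> l i) ->
  \sum_i f i k @[k --> \oo] --> \sum_i l i.
Proof. by move=> h; apply: cvg_big => [|i _]; [exact: add_continuous|]. Qed.

Lemma limn_ge (R : realType) (f : nat -> R) (l a : R) :
  f k @[k --> \oo] --> l -> (forall k, a <= f k) -> a <= l.
Proof. by move=> fl fa; apply: (cvgr_to_ge fl); exact: nearW. Qed.

Lemma polyhedron_col_mx (R : realType) (m n : nat) (A : 'M[R]_(m, n))
    (b : 'cV[R]_m) (u v : 'cV[R]_n) :
  (forall i, 0 <= u i 0) -> (forall i, 0 <= v i 0) ->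
  feasible A b (u - v) -> polyhedron A b (col_mx u v).
Proof.
move=> u0 v0 uv; split.
  by move=> j; rewrite -[j]splitK; case: (fintype.split j) => i /=;
    rewrite ?col_mxEu ?col_mxEd.
by rewrite /feasible /= mul_row_col mulNmx -mulmxBr.
Qed.

(** The split of xi into its positive and negative parts is the cheapest lift
    of xi to the polyhedron. Comparing a minimizer x' with the lift of its own
    difference x shows that x' is that lift; comparing it with the other lifts
    shows that x is a weighted l^1 minimizer. *)
Lemma lifted_minimizer (R : realType) (m n : nat) (A : 'M[R]_(m, n))
    (b : 'cV[R]_m) (eps : R) (xl : 'cV[R]_(n + n)) (wl : 'cV[R]_n) :
  0 < eps -> polyhedron A b xl -> (forall i, slack eps xl i * wl i 0 = 1) ->
  (forall y, polyhedron A b y -> weighted_sum eps xl wl <= weighted_sum eps y wl) ->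
  let x : 'cV[R]_n :=
    \col_(i < n) (xl (lshift n i) 0 - xl (rshift n i) 0) in
  (forall i : 'I_n, wl i 0 = 1 / (`|x i 0| + eps)) /\
  argmin (feasible A b)
    (fun xi : 'cV[R]_n => (\sum_(i < n) wl i 0 * `|xi i 0|)%:E) x.
Proof.
move=> e0 [xl0 xlb] sw opt x.
have s0 i : 0 < slack eps xl i by apply: slack_gt0.
have wE i : wl i 0 = (slack eps xl i)^-1.
  by apply: (mulfI (lt0r_neq0 (s0 i))); rewrite sw mulfV ?gt_eqF.
have w0 i : 0 < wl i 0 by rewrite wE invr_gt0.
have Ax : feasible A b x.
  move: xlb; rewrite /feasible /= -[xl in _ *m xl]vsubmxK mul_row_col mulNmx -mulmxBr.
  move=> <-; congr (_ *m _); apply/matrixP => i j.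
  by rewrite !mxE (ord1 j).
have lift xi : feasible A b xi ->
    weighted_sum eps xl wl <= \sum_(i < n) (`|xi i 0| + eps) * wl i 0.
  move=> hxi; pose u : 'cV[R]_n := \col_i ((`|xi i 0| + xi i 0) / 2).
  pose v : 'cV[R]_n := \col_i ((`|xi i 0| - xi i 0) / 2).
  have xuv : xi = u - v.
    by apply/matrixP => i j; rewrite (ord1 j) !mxE; lra.
  have : polyhedron A b (col_mx u v).
    apply: polyhedron_col_mx; last by rewrite -xuv.
      by move=> i; rewrite mxE; have := ler_norm (- xi i 0); rewrite normrN; lra.
    by move=> i; rewrite mxE; have := ler_norm (xi i 0); lra.
  move/opt => /le_trans; apply; apply: ler_sum => i _.
  by rewrite col_mxEu col_mxEd !mxE ler_pM2r //; lra.
have x_le i : `|x i 0| + eps <= slack eps xl i.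
  rewrite /slack lerD2r mxE; apply: le_trans (ler_normB _ _) _.
  by rewrite !ger0_norm.
have xE i : slack eps xl i = `|x i 0| + eps.
  have := lift x Ax; rewrite /weighted_sum -/(slack _ _ _).
  rewrite -subr_le0 -sumrB => h.
  have t0 j : 0 <= slack eps xl j * wl j 0 - (`|x j 0| + eps) * wl j 0.
    by rewrite -mulrBl mulr_ge0 ?subr_ge0 // ltW.
  have : \sum_(j < n) (slack eps xl j * wl j 0 - (`|x j 0| + eps) * wl j 0) = 0.
    by apply/eqP; rewrite eq_le h sumr_ge0.
  move/eqP; rewrite psumr_eq0 // => /allP /(_ i (mem_index_enum _)).
  by rewrite -mulrBl mulf_eq0 (gt_eqF (w0 i)) orbF subr_eq0 => /eqP.
split; first by move=> i; rewrite wE xE div1r.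
split => // xi /lift; rewrite lee_fin => h.
have -> : \sum_(i < n) wl i 0 * `|x i 0| =
    weighted_sum eps xl wl - \sum_(i < n) eps * wl i 0.
  rewrite /weighted_sum -sumrB; apply: eq_bigr => i _.
  by rewrite -/(slack eps xl i) xE; ring.
rewrite lerBlDr -big_split /=; apply: le_trans h _.
by apply: ler_sum => i _; lra.
Qed.

(** The proximal terms of the first-order conditions are proportional to the steps,
    with coefficients at most 1/rm, and vanish in the limit. *)
Lemma run_limit_critical (R : realType) (m n : nat) (A : 'M[R]_(m, n))
    (b : 'cV[R]_m) (eps rm rp : R) (lam mu : nat -> R)
    (X : nat -> 'cV[R]_(n + n)) (W : nat -> 'cV[R]_n)
    (xl : 'cV[R]_(n + n)) (wl : 'cV[R]_n) :
  prox_run A b eps rm rp lam mu X W ->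
  (forall i, X k i 0 @[k --> \oo] --> xl i 0) ->
  (forall i, W k i 0 @[k --> \oo] --> wl i 0) ->
  [/\ polyhedron A b xl, forall i, slack eps xl i * wl i 0 = 1 &
      forall y, polyhedron A b y ->
        weighted_sum eps xl wl <= weighted_sum eps y wl].
Proof.
move=> hr cX cW; have [e0 rm0 hl hm hx hw hX hW] := hr.
have cXS i : X k.+1 i 0 @[k --> \oo] --> xl i 0.
  by rewrite (cvg_shiftS (fun k => X k i 0)); exact: cX.
have cWS i : W k.+1 i 0 @[k --> \oo] --> wl i 0.
  by rewrite (cvg_shiftS (fun k => W k i 0)); exact: cW.
have cS i : slack eps (X k.+1) i @[k --> \oo] --> slack eps xl i.
  by apply: cvgD; [apply: cvgD|exact: cvg_cst].
have dX i : `|X k.+1 i 0 - X k i 0| @[k --> \oo] --> (0 : R).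
  by rewrite -(normr0 R) -(subrr (xl i 0)); apply: cvg_norm; apply: cvgB.
have dW i : `|W k.+1 i 0 - W k i 0| @[k --> \oo] --> (0 : R).
  by rewrite -(normr0 R) -(subrr (wl i 0)); apply: cvg_norm; apply: cvgB.
split.
- split=> [i|].
    by apply: (limn_ge (cX i)) => k; case: (hX k).
  apply/matrixP => i j; rewrite (ord1 j) mxE.
  have : \sum_l row_mx A (- A) i l * X k l 0 @[k --> \oo] -->
         \sum_l row_mx A (- A) i l * xl l 0.
    by apply: cvg_sumr => l; apply: cvgM; [exact: cvg_cst|exact: cX].
  have -> : (fun k => \sum_l row_mx A (- A) i l * X k l 0) = (fun=> b i 0).
    by apply: funext => k; case: (hX k) => _ <-; rewrite mxE.
  by move=> h; apply: (cvg_unique (@Rhausdorff R) h); exact: cvg_cst.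
- move=> i; apply/eqP; rewrite -subr_eq0 -normr_le0.
  have c1 : `|slack eps (X k.+1) i * W k.+1 i 0 - 1| @[k --> \oo] -->
            `|slack eps xl i * wl i 0 - 1|.
    by apply: cvg_norm; apply: cvgB; [exact: cvgM|exact: cvg_cst].
  have c2 : rm^-1 * `|W k.+1 i 0 - W k i 0| * W k.+1 i 0 @[k --> \oo] -->
            rm^-1 * 0 * wl i 0.
    by apply: cvgM => //; apply: cvgM => //; exact: cvg_cst.
  suff : 0 <= rm^-1 * 0 * wl i 0 - `|slack eps xl i * wl i 0 - 1|.
    by rewrite mulr0 mul0r sub0r oppr_ge0.
  apply: (limn_ge (cvgB c2 c1)) => k; rewrite !fctE.
  have w0 := hW k.+1 i; have /andP[m0 mm] := invr_bounds rm0 (hm k).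
  have -> : slack eps (X k.+1) i * W k.+1 i 0 - 1 =
     (slack eps (X k.+1) i - (W k.+1 i 0)^-1) * W k.+1 i 0.
    by field; rewrite gt_eqF.
  rewrite (w_step_stationary (hw k)) subr_ge0 normrM normrN normrM.
  by rewrite (gtr0_norm w0) (gtr0_norm m0) ler_pM2r // ler_wpM2r.
move=> y Py; rewrite -subr_ge0.
have cF : weighted_sum eps y (W k) - weighted_sum eps (X k.+1) (W k) +
    rm^-1 * \sum_(i < n + n) `|X k.+1 i 0 - X k i 0| * `|y i 0 - X k.+1 i 0|
    @[k --> \oo] -->
    weighted_sum eps y wl - weighted_sum eps xl wl +
    rm^-1 * \sum_(i < n + n) 0 * `|y i 0 - xl i 0|.
  apply: cvgD; [apply: cvgB|apply: cvgM; first exact: cvg_cst].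
  - by apply: cvg_sumr => i; apply: cvgM => //; exact: cvg_cst.
  - by apply: cvg_sumr => i; apply: cvgM => //; exact: cS.
  - apply: cvg_sumr => i; apply: cvgM => //; apply: cvg_norm.
    by apply: cvgB => //; exact: cvg_cst.
have -> : weighted_sum eps y wl - weighted_sum eps xl wl =
    weighted_sum eps y wl - weighted_sum eps xl wl +
    rm^-1 * \sum_(i < n + n) 0 * `|y i 0 - xl i 0|.
  by rewrite big1 ?mulr0 ?addr0 // => i _; rewrite mul0r.
apply: (limn_ge cF) => k /=.
have /andP[l0 ll] := invr_bounds rm0 (hl k).
have lam0 : 0 < lam k by rewrite -invr_gt0.
apply: le_trans (x_step_variational lam0 (hx k) Py) _; rewrite lerD2l.
apply: (@le_trans _ _ ((lam k)^-1 *
    \sum_(i < n + n) `|X k.+1 i 0 - X k i 0| * `|y i 0 - X k.+1 i 0|)).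
  by rewrite ler_pM2l // ler_sum // => i _; rewrite -normrM ler_norm.
by apply: ler_wpM2r => //; apply: sumr_ge0 => i _; rewrite mulr_ge0.
Qed.

(** * The rate of convergence *)

(** The constant p, rather than its square root, uses p <= p^2. *)
Lemma norm2_le (R : realType) (p : nat) (v : 'cV[R]_p) (t : R) :
  0 <= t -> (forall i, `|v i 0| <= t) -> norm2 v <= p%:R * t.
Proof.
move=> t0 hv; have pt0 : 0 <= p%:R * t by rewrite mulr_ge0.
rewrite /norm2 -(ger0_norm pt0) -sqrtr_sqr ler_wsqrtr //.
apply: (@le_trans _ _ (p%:R * t ^+ 2)).
  rewrite mulr_natl -[X in _ <= _ *+ X]card_ord -sumr_const.
  apply: ler_sum => i _; rewrite -real_normK ?num_real //.
  by rewrite ler_sqr ?nnegrE.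
rewrite exprMn ler_wpM2r ?sqr_ge0 // -natrX ler_nat.
by case: (p) => // p'; rewrite leq_pmulr.
Qed.

(** Bernoulli's inequality for 1/q. *)
Lemma geometric_le_harmonic (R : realFieldType) (q : R) (k : nat) :
  0 < q -> q < 1 -> k%:R * q ^+ k <= (q^-1 - 1)^-1.
Proof.
move=> q0 q1; set h := q^-1 - 1.
have h0 : 0 < h by rewrite subr_gt0 invf_gt1.
have qE : q = (1 + h)^-1 by rewrite /h addrCA subrr addr0 invrK.
have bern : 1 + k%:R * h <= (1 + h) ^+ k.
  elim: k => [|k IH]; first by rewrite mul0r addr0 expr0.
  rewrite exprS; apply: (@le_trans _ _ ((1 + h) * (1 + k%:R * h))).
    have : 0 <= k%:R :> R by [].
    rewrite -natr1; nra.
  by rewrite ler_pM2l // addr_gt0.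
have hk0 : 0 < (1 + h) ^+ k by rewrite exprn_gt0 // addr_gt0.
rewrite qE exprVn ler_pdivrMr // mulrC ler_pdivlMr //.
by apply: le_trans bern; rewrite lerDr.
Qed.

Theorem mainTheorem4 (R : realType) (m n : nat) (A : 'M[R]_(m, n))
    (b : 'cV[R]_m) (eps rminus rplus : R) (lam mu : nat -> R)
    (x' : nat -> 'cV[R]_(n + n)) (w : nat -> 'cV[R]_n) :
  (m < n)%N ->
  feasible A b !=set0 ->
  0 < eps ->
  0 < rminus -> rminus < rplus ->
  (forall k : nat, rminus < lam k < rplus) ->
  (forall k : nat, rminus < mu k < rplus) ->
  (forall k : nat, x_step A b eps (lam k) (x' k) (w k) (x' k.+1)) ->
  (forall k : nat, w_step eps (mu k) (x' k.+1) (w k) (w k.+1)) ->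
  exists (xl' : 'cV[R]_(n + n)) (wl : 'cV[R]_n),
    [/\ (x' k, w k) @[k --> \oo] --> (xl', wl),
        (exists d r : R, [/\ 0 < d, 0 < r &
           forall k : nat, (1 <= k)%N ->
             norm2 (col_mx (x' k - xl') (w k - wl)) <= d / (k%:R `^ r)]) &
        let x : 'cV[R]_n :=
          \col_(i < n) (xl' (lshift n i) 0 - xl' (rshift n i) 0) in
        (forall i : 'I_n, wl i 0 = 1 / (`|x i 0| + eps)) /\
        argmin (feasible A b)
          (fun xi : 'cV[R]_n => (\sum_(i < n) wl i 0 * `|xi i 0|)%:E) x].
Proof.
move=> _ _ e0 rm0 _ hl hm hx hw.
pose X k := x' k.+1; pose W k := w k.+1.
(* The initial point need not be feasible nor w^0 positive: start at rank 1. *)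
have run : prox_run A b eps rminus rplus (lam \o succn) (mu \o succn) X W.
  split => //.
  - by move=> k; exact: hl.
  - by move=> k; exact: hm.
  - by move=> k; exact: hx.
  - by move=> k; exact: hw.
  - by move=> k; case: (hx k).
  - by move=> k; exact: w_step_gt0 (hw k).
have [xl [wl [C [q [C0 q0 q1 hX hW]]]]] := run_linear_cvg run.
have [Pxl swl opt] := run_limit_critical run
  (fun i => geometric_bound_cvg q0 q1 (hX ^~ i))
  (fun i => geometric_bound_cvg q0 q1 (hW ^~ i)).
exists xl, wl; split; last exact: lifted_minimizer e0 Pxl swl opt.
- apply: (@cvg_pair _ _ _ _ (nbhs xl) (nbhs wl)).
  + by rewrite -(cvg_shiftS x'); exact: geometric_bound_cvg_mx q0 q1 hX.
  + by rewrite -(cvg_shiftS w); exact: geometric_bound_cvg_mx q0 q1 hW.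
have h0 : 0 < q^-1 - 1 by rewrite subr_gt0 invf_gt1.
pose N : R := (n + n + n)%:R.
exists (N * (C / q / (q^-1 - 1)) + 1), 1; split => //.
  by rewrite ltr_wpDl // mulr_ge0 // ltW // !divr_gt0.
case=> [//|k] _; rewrite powRr1 // ler_pdivlMr //.
have bound i : `|col_mx (x' k.+1 - xl) (w k.+1 - wl) i 0| <= C * q ^+ k.
  rewrite -[i]splitK; case: (fintype.split i) => j /=.
    by rewrite col_mxEu !mxE; exact: hX.
  by rewrite col_mxEd !mxE; exact: hW.
have Cq0 : 0 <= C * q ^+ k by rewrite mulr_ge0 ?exprn_ge0 // ltW.
have := norm2_le Cq0 bound; rewrite -/N => nb.
apply: (@le_trans _ _ (N * (C * q ^+ k) * k.+1%:R)); first by rewrite ler_wpM2r.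
apply: (@le_trans _ _ (N * (C / q / (q^-1 - 1)))); last by rewrite lerDl.
have -> : N * (C * q ^+ k) * k.+1%:R = N * (C / q * (k.+1%:R * q ^+ k.+1)).
  by rewrite exprS; field; rewrite gt_eqF.
rewrite ler_wpM2l // ler_pM2l ?divr_gt0 //.
exact: geometric_le_harmonic.
Qed.
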